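(* Let $m \in \{9, 11, 13\}$ and let $G = J_m$ be the flower snark. Then $G$ is a non-hamiltonian graph having two independent edges $ab$ and $cd$ for which (i) each of $(a,c)$, $(a,d)$, $(b,c)$, $(b,d)$, $((a,b),(c,d))$ is good in $G - \{ab, cd\}$; (ii) for each vertex $v$ of $G$, at least one of $(a,b)$ and $(c,d)$ is good in $G - \{v, ab, cd\}$.
   Context: Graphs are finite, simple and undirected. For an integer $k\ge 1$, the flower snark $J_{2k+1}$ is the graph with vertex set $\{a_i, b_i, c_i, d_i : 0 \le i \le 2k\}$ and edge set $\{b_ia_i,\ b_ic_i,\ b_id_i,\ a_ia_{i+1},\ c_id_{i+1},\ d_ic_{i+1} : 0 \le i \le 2k\}$, where addition in the indices is performed modulo $2k+1$. (The letters $a,b,c,d$ without index in the claim denote arbitrary vertices of $G$.) Two edges are independent if they have no common vertices. In a graph $F$, a pair $(v,w)$ of vertices is good in $F$ if $v, w$ are vertices of $F$ and there exists a hamiltonian path in $F$ with end-vertices $v$ and $w$. Two pairs of vertices $((v,w),(x,y))$ are good in $F$ if there exist two disjoint paths which together span $F$ and which have end-vertices $v$ and $w$, and $x$ and $y$, respectively. $G - \{ab, cd\}$ denotes $G$ with the edges $ab$ and $cd$ deleted, and $G - \{v, ab, cd\}$ denotes $G$ with the vertex $v$ and the edges $ab$, $cd$ deleted (so if $v$ is one of the two vertices of a pair, that pair is not good in $G-\{v,ab,cd\}$). *)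

(* Defs.v *)
From mathcomp Require Import all_boot.

Set Implicit Arguments.
Unset Strict Implicit.
Unset Printing Implicit Defensive.

(* A finite simple graph whose vertices form a subset of an ambient finite
   type, so that deleting a vertex does not change the type. *)
Record graph (T : finType) := Graph {
  vertices : {set T};
  adj : rel T;
  adj_sym : symmetric adj;
  adj_irrefl : irreflexive adj;
  adj_vertices : forall x y, adj x y -> (x \in vertices) && (y \in vertices)
}.

Section Graphs.
Variable T : finType.
Implicit Types (F : graph T) (v w x y : T) (p q c : seq T).

Definition edge x y : {set T} := [set x; y].

Definition independent (e f : {set T}) : bool := [disjoint e & f].

Section DeleteEdges.
Variables (F : graph T) (E : {set {set T}}).

Definition del_edges_adj : rel T :=
  [rel x y | adj F x y && (edge x y \notin E)].

Fact del_edges_sym : symmetric del_edges_adj.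
Proof. by move=> x y; rewrite /del_edges_adj /= (adj_sym F) /edge setUC. Qed.

Fact del_edges_irrefl : irreflexive del_edges_adj.
Proof. by move=> x; rewrite /del_edges_adj /= (adj_irrefl F). Qed.

Fact del_edges_vertices x y :
  del_edges_adj x y -> (x \in vertices F) && (y \in vertices F).
Proof. by case/andP=> /adj_vertices. Qed.

Definition del_edges : graph T :=
  Graph del_edges_sym del_edges_irrefl del_edges_vertices.
End DeleteEdges.

Section DeleteVertex.
Variables (F : graph T) (v : T).

Definition del_vertex_adj : rel T :=
  [rel x y | [&& adj F x y, x != v & y != v]].

Fact del_vertex_sym : symmetric del_vertex_adj.
Proof. by move=> x y; rewrite /del_vertex_adj /= (adj_sym F) [(x != v) && _]andbC. Qed.

Fact del_vertex_irrefl : irreflexive del_vertex_adj.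
Proof. by move=> x; rewrite /del_vertex_adj /= (adj_irrefl F). Qed.

Fact del_vertex_vertices x y :
  del_vertex_adj x y ->
  (x \in vertices F :\ v) && (y \in vertices F :\ v).
Proof.
by case/and3P=> /adj_vertices/andP[Fx Fy] xv yv; rewrite !in_setD1 xv yv Fx.
Qed.

Definition del_vertex : graph T :=
  Graph del_vertex_sym del_vertex_irrefl del_vertex_vertices.
End DeleteVertex.

(* [p] lists all the vertices of the path in order, both ends included. *)
Definition path_between F v w p : Prop :=
  [/\ {subset p <= vertices F}, uniq p
    & exists2 p', p = v :: p' & path (adj F) v p' /\ last v p' = w].

Definition good_pair F v w : Prop :=
  [/\ v \in vertices F, w \in vertices F
    & exists2 p, path_between F v w p & p =i vertices F].

Definition good_two_pairs F v w x y : Prop :=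
  exists p q, [/\ path_between F v w p, path_between F x y q,
    [disjoint p & q] & p ++ q =i vertices F].

Definition hamiltonian F : Prop :=
  exists c, [/\ 3 <= size c, ucycle (adj F) c & c =i vertices F].

End Graphs.

(* The four letters a, b, c, d are encoded as 0, 1, 2, 3 in 'I_4. *)
Definition snark_vertex (m : nat) : finType := ('I_4 * 'I_m)%type.

Section FlowerSnark.
Variable m : nat.
Implicit Type i : 'I_m.

Definition va i : snark_vertex m := (@Ordinal 4 0 isT, i).
Definition vb i : snark_vertex m := (@Ordinal 4 1 isT, i).
Definition vc i : snark_vertex m := (@Ordinal 4 2 isT, i).
Definition vd i : snark_vertex m := (@Ordinal 4 3 isT, i).

(* [ordS i] is [i + 1] modulo [m]. *)
Definition snark_edges i : seq (snark_vertex m * snark_vertex m) :=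
  [:: (vb i, va i); (vb i, vc i); (vb i, vd i);
      (va i, va (ordS i)); (vc i, vd (ordS i)); (vd i, vc (ordS i))].

(* The guard [x != y] only matters for the loop at [va ord0] when [m = 1];
   the flower snarks are the graphs with [m] odd and [m >= 3]. *)
Definition snark_adj : rel (snark_vertex m) :=
  [rel x y | (x != y) &&
    [exists i, ((x, y) \in snark_edges i) || ((y, x) \in snark_edges i)]].

Fact snark_sym : symmetric snark_adj.
Proof.
move=> x y; rewrite /snark_adj /= eq_sym; congr (_ && _).
by apply: eq_existsb => i; rewrite orbC.
Qed.

Fact snark_irrefl : irreflexive snark_adj.
Proof. by move=> x; rewrite /snark_adj /= eqxx. Qed.

Fact snark_vertices x y : snark_adj x y ->
  (x \in [set: snark_vertex m]) && (y \in [set: snark_vertex m]).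
Proof. by rewrite !in_setT. Qed.

Definition flower_snark : graph (snark_vertex m) :=
  Graph snark_sym snark_irrefl snark_vertices.
End FlowerSnark.

(* Main.v *)
Require Import Defs.
From Stdlib Require Import NArith.
From mathcomp Require Import all_boot.

(* A hamiltonian cycle of [J_m] would have even length, so alternating two
   colours along it and giving a third one to the remaining edges would 3-colour
   the edges of this cubic graph. Such a colouring restricts to a triple of
   colours on the three edges between consecutive blocks, and going from one
   block to the next negates a suitable parity of this triple: the sign of the
   permutation when the three colours are distinct; when exactly two coincide,
   the minority colour stays the same and the majority one alternates between
   the two others. As [m] is odd, going once around is impossible.
   The two independent edges are [a_0 b_0] and [a_3 b_3], and the paths they
   require were found by a computer search. *)

Set Implicit Arguments.
Unset Strict Implicit.
Unset Printing Implicit Defensive.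

(** * Edge colourings from hamiltonian cycles *)

Lemma index_next (T : eqType) (c : seq T) x :
  uniq c -> x \in c -> index (next c x) c = (index x c).+1 %% size c.
Proof.
case: c => // y p Uc cx; rewrite next_nth cx [size _]/=.
have:= cx; rewrite -index_mem ltnS leq_eqVlt => /predU1P[->|lt_x].
  by rewrite modnn nth_default //= eqxx.
by rewrite modn_small // -[nth y p _]/(nth y (y :: p) _.+1) index_uniq.
Qed.

Section EdgeColouring.
Variables (T : finType) (F : graph T).

(** The even length keeps the alternation consistent where the cycle closes up, and degree at most 3
    leaves at most one edge per vertex for the colour [None]. *)
Lemma hamiltonian_edge_colouring :
    hamiltonian F -> ~~ odd #|vertices F| -> (forall x, #|adj F x| <= 3) ->
  exists col : T -> T -> option bool,
    (forall x y, col x y = col y x) /\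
    forall x, {in adj F x &, injective (col x)}.
Proof.
case=> c [c3 /andP[cyc Uc] cF] evF deg3.
have ev_c: odd (size c) = false.
  by rewrite -(card_uniqP Uc) (eq_card cF); apply/negbTE.
pose pos x := odd (index x c).
have pos_next x: x \in c -> pos (next c x) = ~~ pos x.
  by move=> cx; rewrite /pos index_next // odd_mod.
(* On a cycle of length at least 3, the successor of a vertex differs from its predecessor. *)
have next2 x: x \in c -> next c (next c x) != x.
  move=> cx; apply/eqP=> /(congr1 (index^~ c)).
  rewrite !index_next ?mem_next // -addn1 modnDml addn1.
  set i := index x c; have lt_i: i < size c by rewrite index_mem.
  rewrite -[RHS](modn_small lt_i) -addn2 => /eqP.
  by rewrite -[X in _ == X %[mod _]]addn0 eqn_modDl mod0n modn_small.
have Fc x y: adj F x y -> (x \in c) && (y \in c).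
  by rewrite !cF; apply: adj_vertices.
exists (fun x y => if y == next c x then Some (pos x)
                   else if x == next c y then Some (pos y) else None).
split=> [x y|x y z].
  have [yx|_] := eqVneq y (next c x); have [xy|_] := eqVneq x (next c y) => //.
  have [cx|ncx] := boolP (x \in c).
    by case/eqP: (next2 x cx); rewrite -yx -xy.
  (* Off [c], [next] is the identity, so [y] is [x]. *)
  by move: yx; rewrite next_nth (negbTE ncx) => ->.
rewrite ![_ \in adj F x]unfold_in => xy xz.
have [cx cy] := andP (Fc _ _ xy); have [_ cz] := andP (Fc _ _ xz).
have xE u: u \in c -> x = next c u -> Some (pos x) <> Some (pos u).
  by move=> cu ->; rewrite pos_next //; case: (pos u).
case: (y =P _) => [-> | /eqP yn]; case: (z =P _) => [-> // | /eqP zn].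
- by case: (x =P _) => // /xE-/(_ cz).
- by case: (x =P _) => // /xE-/(_ cy) neq /esym.
case: (x =P _) => [yx | /eqP yp]; case: (x =P _) => [zx | /eqP zp] // _.
  by apply: (can_inj (prev_next Uc)); rewrite -yx.
have p_x: next c (prev c x) = x by rewrite next_prev.
have cp: prev c x \in c by rewrite mem_prev.
(* Otherwise [y], [z] and the two cycle neighbours of [x] would exceed the degree bound. *)
apply: contraTeq (deg3 x) => yz; rewrite -ltnNge.
have /card_uniqP/= <- : uniq [:: y; z; next c x; prev c x].
  rewrite /= !inE !negb_or yz yn zn andbT /=.
  apply/and3P; split.
  - by apply: contraNneq yp => ->; rewrite p_x.
  - by apply: contraNneq zp => ->; rewrite p_x.
  - by apply: contraNneq (next2 _ cp) => nE; rewrite p_x nE.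
apply/subset_leq_card/subsetP=> u; rewrite !inE unfold_in.
case/or4P=> /eqP-> //; first exact: next_cycle.
by have:= prev_cycle cyc cx; rewrite (adj_sym F).
Qed.

End EdgeColouring.

(* The colours of [a_i a_(i+1)], [c_i d_(i+1)] and [d_i c_(i+1)], in this order. *)
Definition cut_state := (option bool * option bool * option bool)%type.

Definition next_colour (c : option bool) : option bool :=
  match c with None => Some true | Some true => Some false | Some false => None end.

(** If two colours coincide, [p] is the majority colour and [q] the minority one; otherwise the test
    is the sign of the permutation. In a proper colouring the three are never all equal, since only
    two colours would be left for the three spokes of the next block. *)
Definition cut_parity (s : cut_state) : bool :=
  let: (x, y, z) := s in
  let: (p, q) := if x == y then (x, z) else if y == z then (y, x)
                 else if x == z then (x, y) else (x, y) in
  q == next_colour p.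

(** [r], [s], [t] are the colours of the spokes to [a], [c], [d] in the block being crossed. As [c]
    and [d] swap between blocks, [z] arrives where [y'] leaves. For distinct colours, [(x', y', z')]
    is a cyclic shift of [(x, z, y)], hence the negated sign. *)
Lemma cut_parity_step x y z r s t x' y' z' :
    uniq [:: r; s; t] ->
    uniq [:: r; x; x'] -> uniq [:: s; z; y'] -> uniq [:: t; y; z'] ->
  cut_parity (x', y', z') = ~~ cut_parity (x, y, z).
Proof.
by case: r => [[]|]; case: s => [[]|] //; case: t => [[]|] //;
   case: x => [[]|] //; case: x' => [[]|] //; case: z => [[]|] //;
   case: y' => [[]|] //; case: y => [[]|] //; case: z' => [[]|].
Qed.

(** * Adjacency in flower snarks and non-hamiltonicity *)

Section Snark.
Variable m : nat.
Implicit Types (i : 'I_m) (x y : snark_vertex m).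

Lemma iter_ordS k i : iter k (@ordS m) i = (i + k) %% m :> nat.
Proof.
elim: k => [|k IHk]; first by rewrite addn0 modn_small.
by rewrite /= IHk -addn1 modnDml addn1 addnS.
Qed.

Lemma iter_ordS_period i : iter m (@ordS m) i = i.
Proof. by apply: val_inj; rewrite /= iter_ordS modnDr modn_small. Qed.

(** An explicit list makes adjacency computable; the turns of a walk refer to the order of its
    entries. *)
Definition snark_nbrs x : seq (snark_vertex m) :=
  let: i := x.2 in
  match val x.1 with
  | 0 => [:: vb i; va (ordS i); va (ord_pred i)]
  | 1 => [:: va i; vc i; vd i]
  | 2 => [:: vb i; vd (ordS i); vd (ord_pred i)]
  | _ => [:: vb i; vc (ordS i); vc (ord_pred i)]
  end.

Lemma snark_adjE x y : 1 < m -> adj (flower_snark m) x y = (y \in snark_nbrs x).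
Proof.
move=> m1.
have va_neq i : va (ordS i) != va i.
  rewrite xpair_eqE /= -val_eqE /=; have := ltn_ord i.
  rewrite leq_eqVlt => /predU1P[im|lt_im]; last by rewrite modn_small // neq_ltn ltnSn orbT.
  by rewrite im modnn; case: (val i) im m1 => // <-.
apply/andP/idP=> [[_ /existsP[i]]|].
  rewrite !inE -!orbA.
  by do ![case/orP]; case/eqP=> -> ->; rewrite /snark_nbrs /= !inE ?ordSK !eqxx ?orbT.
have edge_x i x' y' : ((x', y') \in snark_edges i) || ((y', x') \in snark_edges i) ->
    [exists i, ((x', y') \in snark_edges i) || ((y', x') \in snark_edges i)].
  by move=> xy; apply/existsP; exists i.
case: x => [[[|[|[|[|//]]]] lt4] i]; rewrite (bool_irrelevance lt4 isT) /snark_nbrs /= !inE;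
  (* With the index written as [ordS j], spokes and edges to the next block are listed under
     [ordS j], edges to the previous block under [j]. *)
  rewrite -[i]ord_predK ?ordSK; move: (ord_pred i) => j; case/or3P=> /eqP->; split=> //;
  try by [rewrite eq_sym va_neq | rewrite va_neq];
  by [apply: (edge_x (ordS j)); rewrite !inE !eqxx ?orbT | apply: (edge_x j); rewrite !inE !eqxx ?orbT].
Qed.

Lemma snark_not_hamiltonian : odd m -> 2 < m -> ~ hamiltonian (flower_snark m).
Proof.
move=> odd_m m2 ham.
have adjE x y : adj (flower_snark m) x y = (y \in snark_nbrs x).
  by apply: snark_adjE; apply: ltnW.
(* The blocks before and after a given one are distinct, so the edges of a vertex towards them get
   different colours. *)
have ordS2 i : ordS (ordS i) != i.
  rewrite -val_eqE -[ordS _]/(iter 2 _ i) [val _]iter_ordS -[X in _ == X](modn_small (ltn_ord i)).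
  by rewrite -[X in _ == X %[mod _]]addn0 eqn_modDl mod0n modn_small.
have [||col [colC col_inj]] := hamiltonian_edge_colouring ham.
- by rewrite cardsT card_prod !card_ord oddM.
- move=> x; rewrite (eq_card (adjE x)); apply: leq_trans (card_size _) _.
  by case: x => [[[|[|[|]]] ?] ?].
have col_neq x y z : y \in snark_nbrs x -> z \in snark_nbrs x -> y != z ->
    col x y != col x z.
  by rewrite -!adjE => xy xz; apply: contraNneq => /(col_inj x y z xy xz)->.
pose cut i : cut_state :=
  (col (va i) (va (ordS i)), col (vc i) (vd (ordS i)), col (vd i) (vc (ordS i))).
have step i : cut_parity (cut (ordS i)) = ~~ cut_parity (cut i).
  rewrite /cut (colC (va i)) (colC (vc i)) (colC (vd i)).
  apply: (@cut_parity_step _ _ _ (col (vb (ordS i)) (va (ordS i)))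
    (col (vb (ordS i)) (vc (ordS i))) (col (vb (ordS i)) (vd (ordS i)))).
    by rewrite /= !inE !negb_or !col_neq // !inE eqxx ?orbT.
  1-3: rewrite (colC (vb _)) /= !inE !negb_or !col_neq // ?inE ?ordSK ?eqxx ?orbT //.
  1-3: by rewrite xpair_eqE /= eq_sym ordS2.
have iter_step k i : cut_parity (cut (iter k (@ordS m) i)) = odd k (+) cut_parity (cut i).
  by elim: k => // k IHk; rewrite iterS step IHk -addNb.
pose i0 : 'I_m := Ordinal (ltnW (ltnW m2)).
by have:= iter_step m i0; rewrite iter_ordS_period odd_m; case: cut_parity.
Qed.

End Snark.

(** * Spanning paths from explicit sequences *)

Section SpanningPaths.
Variables (T : finType) (F : graph T).

Lemma path_betweenI v p : v \in vertices F -> path (adj F) v p -> uniq (v :: p) ->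
  path_between F v (last v p) (v :: p).
Proof.
move=> Fv Fp Up; split=> //; last by exists p.
apply/allP; rewrite /= Fv /=; elim: p v Fp {Fv Up} => //= y p IHp v /andP[vy Fp].
by rewrite (IHp y) // andbT; case/andP: (adj_vertices vy).
Qed.

Lemma spanning_seq (p : seq T) :
  {subset p <= vertices F} -> uniq p -> size p = #|vertices F| -> p =i vertices F.
Proof.
by move=> Fp /card_uniqP Up sz_p; apply/subset_cardP; [rewrite Up | apply/subsetP].
Qed.

Lemma good_pairI v p : v \in vertices F -> path (adj F) v p -> uniq (v :: p) ->
  (size p).+1 = #|vertices F| -> good_pair F v (last v p).
Proof.
move=> Fv Fp Up sz_p; have bp := path_betweenI Fv Fp Up; have [sF _ _] := bp.
by split; rewrite ?sF ?mem_head ?mem_last //; exists (v :: p); last apply: spanning_seq.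
Qed.

Lemma del_vertex_path x v p :
  x \notin v :: p -> path (adj F) v p -> path (adj (del_vertex F x)) v p.
Proof.
elim: p v => //= y p IHp v; rewrite inE negb_or => /andP[xv xp] /andP[vy Fp].
rewrite /del_vertex_adj /= vy (eq_sym v) (eq_sym y) xv IHp // andbT.
by apply: contraNneq xp => ->; rewrite mem_head.
Qed.

Lemma good_two_pairsI v p x q : v \in vertices F -> x \in vertices F ->
    path (adj F) v p -> path (adj F) x q -> uniq ((v :: p) ++ x :: q) ->
    (size p).+1 + (size q).+1 = #|vertices F| ->
  good_two_pairs F v (last v p) x (last x q).
Proof.
move=> Fv Fx Fp Fq Upq sz_pq; have := Upq; rewrite cat_uniq => /and3P[Up dis Uq].
have bp := path_betweenI Fv Fp Up; have bq := path_betweenI Fx Fq Uq.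
exists (v :: p), (x :: q); split=> //.
  by rewrite disjoint_sym disjoint_has.
have [[sp _ _] [sq _ _]] := (bp, bq).
apply: spanning_seq => //; last by rewrite size_cat.
by move=> y; rewrite mem_cat => /orP[/sp|/sq].
Qed.

(* The walk of length [n] that has just gone from [p] to [x]; the successive
   bits of [turns], lowest first, tell which of the neighbours other than the
   one it comes from the walk goes to. A walk starting at [x] has [p = x]. *)
Fixpoint walk (nbrs : T -> seq T) n (turns : N) p x : seq T :=
  if n is n'.+1 then
    let y := nth x [seq y <- nbrs x | y != p] (N.odd turns) in
    y :: walk nbrs n' (N.div2 turns) x y
  else [::].

Lemma size_walk nbrs n turns p x : size (walk nbrs n turns p x) = n.
Proof. by elim: n turns p x => //= n IHn turns p x; rewrite IHn. Qed.

End SpanningPaths.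

(** * Checking certificates by computation *)

Section Certificates.
Variables (m : nat) (i0 : 'I_m).

Let a := va i0.
Let b := vb i0.
Let c := va (iter 3 (@ordS m) i0).
Let d := vb (iter 3 (@ordS m) i0).
Let F := del_edges (flower_snark m) [set edge a b; edge c d].

Definition del_nbrs x : seq (snark_vertex m) :=
  [seq y <- snark_nbrs x | (x, y) \notin [:: (a, b); (b, a); (c, d); (d, c)]].

Lemma del_nbrs_adj : 1 < m -> subrel [rel x y | y \in del_nbrs x] (adj F).
Proof.
move=> m1 x y; rewrite /= mem_filter -(snark_adjE x y m1) => /andP[nE xy].
rewrite /del_edges_adj /=; apply/andP; split=> //; apply: contra nE.
have neq_xy: x != y by case/andP: xy.
have edgeE u v : edge x y == edge u v -> (x, y) \in [:: (u, v); (v, u)].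
  move=> /eqP eE; have:= set21 x y; have := set22 x y.
  rewrite -[[set x; y]]/(edge x y) eE !inE !xpair_eqE.
  by case/orP=> /eqP yE /orP[]/eqP xE; move: neq_xy; rewrite xE yE !eqxx ?orbT.
rewrite !inE => /orP[] /edgeE; rewrite !inE => /orP[] ->; by rewrite ?orbT.
Qed.

Definition snark_vertices_from : seq (snark_vertex m) :=
  flatten [seq [:: va i; vb i; vc i; vd i] | i <- traject (@ordS m) i0 m].

Lemma mem_snark_vertices_from x : x \in snark_vertices_from.
Proof.
case: x => t i; apply/flatten_mapP; exists i; last first.
  by case: t => [[|[|[|[|//]]]] lt4]; rewrite (bool_irrelevance lt4 isT) !inE eqxx ?orbT.
(* The number of steps forward from [i0] to [i], arranged to avoid truncated subtraction. *)
apply/trajectP; exists ((i + (m - i0)) %% m); first by rewrite ltn_mod (leq_trans _ (ltn_ord i)).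
apply: val_inj; rewrite /= iter_ordS modnDmr addnCA subnKC ?modnDr ?modn_small //.
exact: ltnW.
Qed.

(** The turns need no trust: at a dead end [nth] returns the current vertex, and the path test then
    fails. *)
Definition turns_join k turns v w :=
  let p := walk del_nbrs k turns v v in
  [&& path [rel x y | y \in del_nbrs x] v p, uniq (v :: p) & last v p == w].

(* The second component gives the two disjoint paths, preceded by the length of
   the first one. The last one has an entry per vertex; its lowest bit chooses
   between the pairs [(a, b)] (set) and [(c, d)] (clear), and the other bits
   are the turns of the path. *)
Definition certificate : Type := (seq N * (nat * N * N) * seq N)%type.

(** Steps are one fewer than vertices: a spanning path has [4 * m - 1], two disjoint spanning paths
    have [4 * m - 2] together, and so does a path missing one vertex. *)
Definition valid_certificate (cert : certificate) : bool :=
  let: (turns, (k, turns1, turns2), del_turns) := cert in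
  [&& all2 (fun vw t => turns_join (4 * m).-1 t vw.1 vw.2)
        [:: (a, c); (a, d); (b, c); (b, d)] turns,
      (let p := walk del_nbrs k turns1 a a in
       let q := walk del_nbrs (4 * m - k.+2) turns2 c c in
       [&& k.+2 <= 4 * m, turns_join k turns1 a b,
           turns_join (4 * m - k.+2) turns2 c d
         & uniq ((a :: p) ++ c :: q)])
    & all2 (fun x t =>
        let: (v, w) := if N.odd t then (a, b) else (c, d) in
        (x \notin v :: walk del_nbrs (4 * m).-2 (N.div2 t) v v)
          && turns_join (4 * m).-2 (N.div2 t) v w)
        snark_vertices_from del_turns].

Lemma card_snark : #|vertices (flower_snark m)| = 4 * m.
Proof. by rewrite cardsT card_prod !card_ord. Qed.

Lemma turns_join_good t v w :
  1 < m -> turns_join (4 * m).-1 t v w -> good_pair F v w.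
Proof.
move=> m1 /and3P[vp Up /eqP<-]; apply: good_pairI => //.
- exact: sub_path (del_nbrs_adj m1) _ _ vp.
- by rewrite size_walk card_snark prednK // muln_gt0 (ltnW m1).
Qed.

Lemma turns_join_good_del x t v w : 1 < m ->
    x \notin v :: walk del_nbrs (4 * m).-2 t v v ->
    turns_join (4 * m).-2 t v w -> good_pair (del_vertex F x) v w.
Proof.
move=> m1 xp /and3P[vp Up /eqP<-]; apply: good_pairI => //.
- by rewrite /= !inE andbT; apply: contraNneq xp => ->; rewrite mem_head.
- by apply: del_vertex_path => //; apply: sub_path (del_nbrs_adj m1) _ _ vp.
apply: succn_inj; rewrite size_walk; have := cardsD1 x (vertices F).
rewrite inE card_snark => mE; apply: etrans mE; rewrite -subn2 -addn2 subnK //.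
exact: leq_trans m1 (leq_pmull _ _).
Qed.

Lemma valid_certificate_good cert : 1 < m -> valid_certificate cert ->
  let G := flower_snark m in
  exists a b c d : snark_vertex m,
    [/\ adj G a b, adj G c d, independent (edge a b) (edge c d),
        (let F := del_edges G [set edge a b; edge c d] in
         [/\ good_pair F a c, good_pair F a d, good_pair F b c,
             good_pair F b d & good_two_pairs F a b c d])
      & forall v : snark_vertex m, v \in vertices G ->
          let F := del_vertex (del_edges G [set edge a b; edge c d]) v in
          good_pair F a b \/ good_pair F c d].
Proof.
case: cert => [[turns [[k t1] t2]] del_turns] m1 /and3P[].
case: turns => [|tac [|tad [|tbc [|tbd []]]]]; rewrite /= ?andbF // andbT.
case/and4P=> good_ac good_ad good_bc good_bd.
case/and4P=> le_k /and3P[ap _ /eqP p_b] /and3P[cq _ /eqP q_d] Upq good_del.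
have [_ dis_pq _] := and3P (etrans (esym (@cat_uniq _ (a :: _) (c :: _))) Upq).
have spoke i : adj (flower_snark m) (va i) (vb i) by rewrite snark_adjE // mem_head.
exists a, b, c, d; split; try exact: spoke.
(* Independence comes from the two disjoint paths, each containing both ends of its edge. *)
- have sub_edge (x y : snark_vertex m) s : last x s = y -> {subset edge x y <= x :: s}.
    by move=> <- z; rewrite !inE => /orP[]/eqP->; rewrite -?in_cons ?mem_head ?mem_last.
  rewrite /independent disjoint_sym.
  apply/pred0P=> z /=; apply: contraNF dis_pq => /andP[/(sub_edge _ _ _ q_d) qz].
  by move=> /(sub_edge _ _ _ p_b) pz; apply/hasP; exists z.
- split; first [exact: turns_join_good good_ac | exact: turns_join_good good_ad
    | exact: turns_join_good good_bc | exact: turns_join_good good_bd | idtac].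
  suff: good_two_pairs F a (last a (walk del_nbrs k t1 a a))
          c (last c (walk del_nbrs (4 * m - k.+2) t2 c c)) by rewrite p_b q_d.
  have subF := sub_path (del_nbrs_adj m1).
  apply: good_two_pairsI; rewrite ?in_setT //; try exact: subF.
  by rewrite !size_walk card_snark addnS -addSn subnKC.
move=> v _; move: good_del; rewrite all2E => /andP[/eqP sz /(all_nthP (v, N0))].
move=> /(_ (index v snark_vertices_from)).
rewrite size1_zip ?sz // -sz index_mem mem_snark_vertices_from => /(_ isT).
rewrite nth_zip //= nth_index ?mem_snark_vertices_from //.
by case: N.odd => /andP[vp vw]; [left | right]; apply: turns_join_good_del vw.
Qed.

End Certificates.

(** * Certificates for the three snarks *)

Definition certificate_9 : certificate :=
 ([:: 0x7c9492152; 0x3cb8b3c00; 0xf531a282; 0x3f50ee990],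
  (20%N, 0x8030, 0x1f79),
  [::
    0x3c3833870; 0x3ae636a62; 0x395078787; 0x385078787; 0x3535212a3;
    0x3c3c2c8f0; 0x2826a626a; 0x202626a62; 0x3c3c283b0; 0x2bc1e1c0e;
    0x390787079; 0x310707871; 0x353122a63; 0x3ea717871; 0x2b426a6a4;
    0x2a426a6a4; 0x3191b52a2; 0x3e1c0c5e4; 0x3111b522a; 0x3191b5222;
    0x3b8703170; 0x3191bace2; 0x3b1703178; 0x331703170; 0x3191aaa62;
    0x3c8f13170; 0x3191aa362; 0x3191a2362; 0x3c3b03170; 0x3198eea62;
    0x3cb313170; 0x3cb303170; 0x3898bc3b1; 0x3c3c8b170; 0x3182b6362;
    0x318226a62])%num.

Definition certificate_11 : certificate :=
 ([:: 0x7f252492152; 0x3c383c33c00; 0xf135312282; 0x3fd43ba6990],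
  (26%N, 0x200030, 0x7f79),
  [::
    0x3cb8b833870; 0x384ea626a62; 0x39507078787; 0x38507078787; 0x35b1b5212a3;
    0x3cb8bc2c8f0; 0x282626a626a; 0x2026a626a62; 0x3cb8bc283b0; 0x2be1c1e1c0e;
    0x39070787079; 0x31078707871; 0x35b1b122a63; 0x3c0f8707871; 0x2b42626a6a4;
    0x2a42626a6a4; 0x3191b1352a2; 0x3e5c5c0c5e4; 0x3111b53522a; 0x3191b535222;
    0x3b971703170; 0x3191b53ace2; 0x3b178703178; 0x33178703170; 0x3191b12aa62;
    0x3c8f8703170; 0x3191b522a62; 0x3191b122362; 0x3c3b0713170; 0x3191b8cea62;
    0x3cb38703170; 0x3cb30713170; 0x3191aa26a62; 0x3c3e8f03170; 0x3191aa36a62;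
    0x3191a236a62; 0x3cb8bb03170; 0x3198ee26a62; 0x3c3c3313170; 0x3c3c3303170;
    0x3898b83c3b1; 0x3cb8bc8b170; 0x3182a626a62; 0x3182a636a62])%num.

Definition certificate_13 : certificate :=
 ([:: 0x7fc9492492152; 0x3cb8b83c33c00; 0xf531b5312282; 0x3ff50ee9a6990],
  (32%N, 0x8000030, 0x1ff79),
  [::
    0x3c383c3833870; 0x3ae636a626a62; 0x3950787078787; 0x3850787078787;
    0x35313535212a3; 0x3c383c3c2c8f0; 0x2826a626a626a; 0x202626a626a62;
    0x3c383c3c283b0; 0x2bc1e1c1e1c0e; 0x3907870787079; 0x3107078707871;
    0x3531353122a63; 0x3ea7178707871; 0x2b426a626a6a4; 0x2a426a626a6a4;
    0x3191b531352a2; 0x3e1c1e1c0c5e4; 0x3111b1353522a; 0x3191b13535222;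
    0x3b87078703170; 0x3191b1353ace2; 0x3b17078703178; 0x3317078703170;
    0x3191b5312aa62; 0x3eaf178703170; 0x3191b53522a62; 0x3191b53122362;
    0x3c3b078703170; 0x3191b138cea62; 0x3c3b178703170; 0x3cb3078703170;
    0x3191b52a26a62; 0x3cbcaf8703170; 0x3191b52a36a62; 0x3191b52226a62;
    0x3c383b8703170; 0x3191bace26a62; 0x3c3c338703170; 0x3c38331703170;
    0x3191aaa626a62; 0x3cb8be8f03170; 0x3191aa3626a62; 0x3191a23626a62;
    0x3c383c3b03170; 0x3198eea626a62; 0x3cb8bc3313170; 0x3cb8bc3303170;
    0x3898bc383c3b1; 0x3c383c3c8b170; 0x3182b63626a62; 0x318226a626a62])%num.

(* [vm_compute] is slower here: it evaluates the proofs inside the ordinals. *)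
Lemma certificate_9P : valid_certificate (@ord0 8) certificate_9.
Proof. by lazy. Qed.

Lemma certificate_11P : valid_certificate (@ord0 10) certificate_11.
Proof. by lazy. Qed.

Lemma certificate_13P : valid_certificate (@ord0 12) certificate_13.
Proof. by lazy. Qed.

Theorem lemma3p3 (m : nat) (hm : m \in [:: 9; 11; 13]) :
  let G := flower_snark m in
  ~ hamiltonian G /\
  exists a b c d : snark_vertex m,
    [/\ adj G a b, adj G c d, independent (edge a b) (edge c d),
        (let F := del_edges G [set edge a b; edge c d] in
         [/\ good_pair F a c, good_pair F a d, good_pair F b c,
             good_pair F b d & good_two_pairs F a b c d])
      & forall v : snark_vertex m, v \in vertices G ->
          let F := del_vertex (del_edges G [set edge a b; edge c d]) v in
          good_pair F a b \/ good_pair F c d].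
Proof.
move: hm; rewrite !inE => /or3P m_cases; split.
  by apply: snark_not_hamiltonian; case: m_cases => /eqP->.
case: m_cases => /eqP->; apply: valid_certificate_good => //.
- exact: certificate_9P.
- exact: certificate_11P.
- exact: certificate_13P.
Qed.
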